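(* For $n \geq 4$, a connected graph $G$ of order $n$ satisfies $\mathrm{vp}^-(G) = \mathrm{vp}(G) = n-2$ if and only if $G$ is isomorphic to a clique of even order with a perfect matching deleted, i.e. if and only if $G \cong K_{2,2,\dots,2}$.
   Context: All graphs are finite, undirected and simple. $K_{2,2,\dots,2}$ denotes a complete multipartite graph all of whose partite sets have size two. A $u,v$-geodesic is a shortest $u,v$-path. For a vertex $x$ of $G$, a set $S \subseteq V(G)$ is an $x$-position set if for every $y \in S$ no vertex of $S \setminus \{y\}$ lies on any $x,y$-geodesic in $G$. The $x$-position number $p_x(G)$ is the maximum cardinality of an $x$-position set of $G$. Define $\mathrm{vp}(G) = \max_{x \in V(G)} p_x(G)$ and $\mathrm{vp}^-(G) = \min_{x \in V(G)} p_x(G)$. *)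

(* Defs.v *)
From mathcomp Require Import all_boot.
From mathcomp Require Import boolp.

Set Implicit Arguments.
Unset Strict Implicit.
Unset Printing Implicit Defensive.

(* A finite simple graph is given by a finite vertex type and a symmetric,
   irreflexive adjacency relation on it. *)
Definition simple_graph (V : finType) (e : rel V) : Prop :=
  symmetric e /\ irreflexive e.

Definition connected_graph (V : finType) (e : rel V) : Prop :=
  forall u v : V, connect e u v.

Definition graph_iso (V W : finType) (e : rel V) (f : rel W) : Prop :=
  exists2 h : V -> W, bijective h & forall u v, f (h u) (h v) = e u v.

(* As in mathcomp's [path], the vertex sequence of the path is [u :: p], and its
   length is [size p]. *)
Definition graph_path (V : finType) (e : rel V) (u v : V) (p : seq V) : Prop :=
  [/\ path e u p, last u p = v & uniq (u :: p)].

Definition geodesic (V : finType) (e : rel V) (u v : V) (p : seq V) : Prop :=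
  graph_path e u v p /\
  (forall q, graph_path e u v q -> size p <= size q).

Definition position_set (V : finType) (e : rel V) (x : V) (S : {set V}) : Prop :=
  forall y, y \in S -> forall z, z \in S :\ y ->
    forall p, geodesic e x y p -> z \notin x :: p.

Definition position_number (V : finType) (e : rel V) (x : V) : nat :=
  \max_(S : {set V} | `[< position_set e x S >]) #|S|.

Definition vp (V : finType) (e : rel V) : nat :=
  \max_(x : V) position_number e x.

(* Every position number is at most [#|V|], so starting the iterated minimum at
   [#|V|] does not affect its value when [V] is nonempty. *)
Definition vp_minus (V : finType) (e : rel V) : nat :=
  \big[minn/#|V|]_(x : V) position_number e x.

Definition clique (n : nat) : rel 'I_n := fun u v => u != v.

(* Edges are the two-element sets [[set u; v]] with [e u v]. *)
Definition perfect_matching (V : finType) (e : rel V) (M : {set {set V}}) : Prop :=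
  (forall A, A \in M -> exists u v : V, e u v /\ A = [set u; v]) /\
  (forall x : V, exists! A : {set V}, A \in M /\ x \in A).

Definition delete_edges (V : finType) (e : rel V) (M : {set {set V}}) : rel V :=
  fun u v => e u v && ([set u; v] \notin M).

(* The partite sets are indexed by ['I_k], the [i]-th one having size [s i]. *)
Definition complete_multipartite (k : nat) (s : 'I_k -> nat) :
    rel {i : 'I_k & 'I_(s i)} :=
  fun u v => tag u != tag v.
Arguments complete_multipartite {k} s.

Definition is_even_clique_minus_perfect_matching (V : finType) (e : rel V) : Prop :=
  exists (m : nat) (M : {set {set 'I_m}}),
    [/\ ~~ odd m, perfect_matching (@clique m) M &
        graph_iso e (delete_edges (@clique m) M)].

Definition is_K222 (V : finType) (e : rel V) : Prop :=
  exists k : nat, graph_iso e (complete_multipartite (fun _ : 'I_k => 2)).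

(* Main.v *)
(** The equality forces every vertex to have exactly one non-neighbour.  If
    [setC [set x; w]] is an [x]-position set then every [y] outside [{x, w}] is
    adjacent to [x] or is reached from [x] only through [w].  When [w] is itself
    adjacent to [x], looking at the graph from a vertex [b] at distance two
    from [x] shows that [w] is adjacent to all other vertices, so its
    neighbourhood is a [w]-position set of size [n - 1], a contradiction.  Hence
    [w] is the unique non-neighbour of [x]. *)
Require Import Defs.
From mathcomp Require Import all_boot.
From mathcomp Require Import boolp.

Set Implicit Arguments.
Unset Strict Implicit.
Unset Printing Implicit Defensive.

(** Common intermediate form of both target descriptions: [s] pairs each vertex with its only
    non-neighbour. *)
Definition cocktail_party (V : finType) (e : rel V) : Prop :=
  exists s : V -> V, [/\ involutive s, forall x, s x != x &
    forall u v, e u v = (v != u) && (v != s u)].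

(** * Geodesics, position sets and position numbers *)

Section Geodesics.

Variables (V : finType) (e : rel V).

Lemma geodesic_exists (u v : V) : connect e u v -> exists p, geodesic e u v p.
Proof.
move=> /connectP[p0 pp0 lp0].
have ex : exists k, `[< exists2 q, graph_path e u v q & size q = k >].
  case/shortenP: pp0 lp0 => q pq uq _ lq.
  by exists (size q); apply/asboolP; exists q.
case: (ex_minnP ex) => k /asboolP[q pq <-] min.
by exists q; split=> // r pr; apply: min; apply/asboolP; exists r.
Qed.

Lemma geodesic_edge (x y : V) (p : seq V) :
  e x y -> x != y -> geodesic e x y p -> p = [:: y].
Proof.
move=> exy xy [[pp lp up] /(_ [:: y])].
have py : graph_path e x y [:: y] by split; rewrite //= ?exy // inE xy.
move=> /(_ py); case: p pp lp up => [|a [|b p]] //=.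
  by move=> _ ex _; rewrite ex eqxx in xy.
by move=> _ ->.
Qed.

Lemma geodesic_two (x a y : V) :
  irreflexive e -> ~~ e x y -> x != y -> e x a -> e a y ->
  geodesic e x y [:: a; y].
Proof.
move=> irr nxy xy exa eay; split.
  split; rewrite //= ?exa ?eay // !inE negb_or xy !andbT.
  by apply/andP; split; apply/eqP => eq; move: exa eay; rewrite eq irr.
case=> [|b [|c q]] //= [] /=.
  by move=> _ eq _; rewrite eq eqxx in xy.
by rewrite andbT => exb eq; rewrite -eq exb in nxy.
Qed.

Lemma position_number_ge (x : V) (S : {set V}) :
  position_set e x S -> #|S| <= position_number e x.
Proof. by move=> pS; apply: leq_bigmax_cond; apply/asboolP. Qed.

Lemma position_number_attained (x : V) :
  exists2 S, position_set e x S & #|S| = position_number e x.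
Proof.
have p0 : `[< position_set e x set0 >] by apply/asboolP => y; rewrite inE.
have [|S /asboolP pS eqS] :=
  @eq_bigmax_cond _ [pred S | `[< position_set e x S >]] (fun S => #|S|).
  by apply/card_gt0P; exists set0.
by exists S.
Qed.

(** The root lies on every geodesic leaving it, and connectedness supplies one to any other member
    of [S]. *)
Lemma position_set_without_root (x : V) (S : {set V}) :
  connected_graph e -> position_set e x S -> 1 < #|S| -> x \notin S.
Proof.
move=> con pS S1; apply/negP => xS.
have /card_gt0P[y] : 0 < #|S :\ x| by move: S1; rewrite (cardsD1 x) xS.
rewrite !inE => /andP[yx yS].
have xSy : x \in S :\ y by rewrite !inE eq_sym yx.
have [p gp] := geodesic_exists (con x y).
by have /negP[] := pS _ yS _ xSy _ gp; rewrite mem_head.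
Qed.

(** A geodesic to a neighbour is a single edge, with no room for another neighbour. This bounds
    every position number below by the degree. *)
Lemma neighbourhood_position_set (x : V) :
  irreflexive e -> position_set e x [set y | e x y].
Proof.
move=> irr y; rewrite inE => exy z; rewrite !inE => /andP[zy exz] p gp.
have xy : x != y by apply: contraTneq exy => ->; rewrite irr.
rewrite (geodesic_edge exy xy gp) !inE negb_or zy andbT.
by apply: contraTneq exz => ->; rewrite irr.
Qed.

Lemma vp_minus_le (x : V) : vp_minus e <= position_number e x.
Proof.
rewrite /vp_minus; have := mem_index_enum x.
elim: (index_enum V) => //= y r IH; rewrite inE big_cons.
case/predU1P=> [->|/IH]; first exact: geq_minl.
exact: leq_trans (geq_minr _ _).
Qed.

Lemma vp_ge (x : V) : position_number e x <= vp e.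
Proof. exact: leq_bigmax. Qed.

Lemma position_number_const (m : nat) : 0 < #|V| -> m <= #|V| ->
  (vp_minus e = m /\ vp e = m) <-> (forall x, position_number e x = m).
Proof.
move=> /card_gt0P[x0 _] mV; split=> [[mn mx] x|h].
  by apply/eqP; rewrite eqn_leq -{1}mx -mn vp_ge vp_minus_le.
split; apply/eqP; rewrite eqn_leq.
  rewrite -{1}(h x0) vp_minus_le /=.
  (* The initial value [#|V|] of the iterated minimum must also be at least [m], which is [mV]. *)
  apply: (big_ind (fun k => m <= k)) => // [a b am bm|x _]; last by rewrite h.
  by rewrite leq_min am.
rewrite -{2}(h x0) vp_ge andbT; apply/bigmax_leqP => x _.
by rewrite h.
Qed.

End Geodesics.

(** * Position numbers all equal to [#|V| - 2] and unique non-neighbours *)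

Section Characterization.

Variables (V : finType) (e : rel V).
Hypotheses (sym : symmetric e) (irr : irreflexive e).
Hypotheses (con : connected_graph e) (V4 : 4 <= #|V|).

(** The neighbourhood of [x] attains the value. A larger position set would be everything except
    [x], but any third vertex is the midpoint of a geodesic from [x] to [s x]. *)
Lemma cocktail_party_position_number (x : V) :
  cocktail_party e -> position_number e x = #|V| - 2.
Proof.
case=> s [ss sx es]; apply/eqP; rewrite eqn_leq; apply/andP; split; last first.
  have := position_number_ge (@neighbourhood_position_set _ _ x irr).
  apply: leq_trans.
  have -> : [set y | e x y] = ~: [set x; s x].
    by apply/setP => y; rewrite !inE es negb_or.
  by rewrite cardsCs setCK cards2 eq_sym sx.
have [S pS <-] := position_number_attained e x; rewrite leqNgt; apply/negP => S2.
have S1 : 1 < #|S| by apply: ltn_trans S2; rewrite ltn_subRL.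
have xS : x \notin S by apply: position_set_without_root S1.
have eqS : S = ~: [set x].
  apply/eqP; rewrite eqEcard; apply/andP; split.
    by apply/subsetP => y yS; rewrite !inE; apply: contraNneq xS => <-.
  by rewrite cardsCs setCK cards1 leq_subLR -ltnS -addSn -ltn_subLR ?(ltnW (ltnW V4)).
have /card_gt0P[y] : 0 < #|~: [set x; s x]|.
  by rewrite cardsCs setCK cards2 subn_gt0 eq_sym sx (leq_trans _ V4).
rewrite !inE negb_or => /andP[yx ysx].
have exy : e x y by rewrite es yx ysx.
have eys : e y (s x).
  by rewrite es eq_sym ysx /= (inj_eq (can_inj ss)) eq_sym.
have g : geodesic e x (s x) [:: y; s x].
  apply: geodesic_two => //; last by rewrite eq_sym.
  by rewrite es eqxx andbF.
have sS : s x \in S by rewrite eqS !inE.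
have yS : y \in S :\ s x by rewrite eqS !inE ysx.
by have /negP[] := pS _ sS _ yS _ g; rewrite !inE eqxx orbT.
Qed.

(** A maximum position set misses [x] and exactly one further vertex [w]. Interior vertices of a
    geodesic from [x] to a member of the set lie outside it, so only [w] can be one. *)
Lemma position_number_witness (x : V) : position_number e x = #|V| - 2 ->
  exists2 w, w != x & forall y, y != x -> y != w -> ~~ e x y ->
    [/\ e x w, e w y & forall a, e x a -> e a y -> a = w].
Proof.
move=> px; have [S pS cS] := position_number_attained e x; rewrite px in cS.
have xS : x \notin S.
  apply: position_set_without_root pS _ => //; rewrite cS.
  by rewrite ltn_subRL.
have /cards2P[u [v [uv eqC]]] : #|~: S| == 2.
  by rewrite cardsCs setCK cS subKn // (leq_trans _ V4).
have [w wx eqS] : exists2 w, w != x & ~: S = [set x; w].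
  have : x \in ~: S by rewrite inE.
  rewrite eqC !inE => /orP[/eqP->|/eqP->]; first by exists v; rewrite // eq_sym.
  by exists u; rewrite // setUC.
have inS z : z \in S = (z != x) && (z != w).
  by rewrite -[S]setCK eqS !inE negb_or.
exists w => // y yx yw nxy.
have yS : y \in S by rewrite inS yx.
have interior z p : geodesic e x y p -> z \in p -> z != y -> z = w.
  move=> gp zp zy; apply/eqP; apply: contraTT zp => zw.
  have zx_or : (z == x) || (z \in S :\ y).
    by rewrite !inE zy inS zw; case: eqP.
  case/predU1P: zx_or => [->|zS]; last first.
    by have := pS _ yS _ zS _ gp; rewrite inE negb_or => /andP[].
  by case: gp => [[_ _ /= /andP[]]].
have uniq_mid a : e x a -> e a y -> a = w.
  move=> exa eay; apply: (interior _ [:: a; y]); last 2 first.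
  - exact: mem_head.
  - by apply: contraTneq eay => ->; rewrite irr.
  by apply: geodesic_two; rewrite // eq_sym.
suff [exw ewy] : e x w /\ e w y by [].
have [p gp] := geodesic_exists (con x y).
have interior_p z := interior z p gp.
case: gp => [[pp lp up] _].
(* Lengths 0 and 1 contradict [y != x] and non-adjacency. Otherwise the first vertex is [w], and the
   next is [y], since a second interior vertex would repeat [w]. *)
case: p pp lp up interior_p => [|a [|b p]] /=.
- by move=> _ xy; rewrite xy eqxx in yx.
- by rewrite andbT => exa ay; rewrite -ay exa in nxy.
case/and3P=> exa eab pp lp /and3P[_ anp unp] mid.
have aw : a = w.
  apply: mid; first exact: mem_head.
  by apply: contraNneq nxy => <-.
have [yb|by_] := eqVneq b y; first by rewrite -aw -yb.
have bw : b = w by apply: mid => //; rewrite !inE eqxx orbT.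
by rewrite aw bw mem_head in anp.
Qed.

(** Otherwise the neighbourhood of [x] would be a position set of size [#|V| - 1]. *)
Lemma non_neighbour_exists (x : V) : position_number e x = #|V| - 2 ->
  exists2 y, y != x & ~~ e x y.
Proof.
move=> px; apply: contrapT => no.
have := position_number_ge (@neighbourhood_position_set _ _ x irr).
have -> : [set y | e x y] = ~: [set x].
  apply/setP => y; rewrite !inE; have [->|yx] := eqVneq y x; first exact: irr.
  by apply: contrapT => /negP nxy; apply: no; exists y.
by rewrite px cardsCs setCK cards1; case: #|V| V4 => [|[|m]] //; rewrite !subSS !subn0 ltnn.
Qed.

Lemma position_number_cocktail_party :
  (forall x, position_number e x = #|V| - 2) -> cocktail_party e.
Proof.
move=> pn.
have wit x := position_number_witness (pn x).
have nonnb x := non_neighbour_exists (pn x).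
have ex x : exists w, (w != x) && [forall y, e x y == (y != x) && (y != w)].
  have [w wx Pw] := wit x; exists w; rewrite wx /=.
  have [exw|nxw] := boolP (e x w); last first.
    apply/forallP => y; apply/eqP.
    have [->|yx] := eqVneq y x; first exact: irr.
    have [->|yw] := eqVneq y w; first exact: negbTE.
    by apply: contraNT nxw => nxy; have [] := Pw y yx yw nxy.
  have [b bx nxb] := nonnb x.
  have bw : b != w by apply: contraNneq nxb => ->.
  have [_ ewb mid] := Pw b bx bw nxb.
  (* With [w] adjacent to [x], a contradiction follows by proving that this non-neighbour [y] of [w]
     is adjacent to [w]. *)
  have [y yw] := nonnb w; case/negP.
  have [->|yx] := eqVneq y x; first by rewrite sym.
  have [exy|nxy] := boolP (e x y); last by have [] := Pw y yx yw nxy.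
  (* By [mid], [w] is the only common neighbour of [x] and [b], and [y] is adjacent to [x]. *)
  have neby : ~~ e b y.
    by apply: contraNN yw; rewrite sym => eyb; apply/eqP/mid.
  have yb : y != b by apply: contraNneq nxb => <-.
  have nbx : ~~ e b x by rewrite sym.
  (* The witness of [b] is not [x]: otherwise the non-neighbour [y] would force [b] and [x] to be
     adjacent. So it is the common neighbour [w], through which [b] reaches [y]. *)
  have [w3 w3b P3] := wit b.
  have [x3|x3] := eqVneq x w3.
    have [|ebw] := P3 y yb _ neby; first by rewrite -x3.
    by rewrite -x3 (negbTE nbx) in ebw.
  have xb : x != b by rewrite eq_sym.
  have [_ _ mid3] := P3 x xb x3 nbx.
  have w3w : w = w3 by apply: mid3; rewrite sym.
  by rewrite -w3w in P3; have [] := P3 y yb yw neby.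
pose s x := xchoose (ex x).
have sx x : s x != x by have /andP[] := xchooseP (ex x).
have es x y : e x y = (y != x) && (y != s x).
  by have /andP[_ /forallP/(_ y)/eqP] := xchooseP (ex x).
(* By symmetry [x] is a non-neighbour of [s x] distinct from it, hence equals [s (s x)]. *)
exists s; split=> // x; apply/esym/eqP.
have : ~~ e (s x) x by rewrite sym es eqxx andbF.
by rewrite es negb_and !negbK eq_sym (negbTE (sx x)).
Qed.

End Characterization.

(** * Complete multipartite graphs with parts of size two *)

Lemma cocktail_party_iso (V W : finType) (e : rel V) (f : rel W) :
  graph_iso e f -> cocktail_party f -> cocktail_party e.
Proof.
case=> h [g hK gK] hf [s [ss sx fs]]; exists (fun x => g (s (h x))); split.
- by move=> x /=; rewrite gK ss hK.
- by move=> x; rewrite (can2_eq gK hK) sx.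
- by move=> u v; rewrite -hf fs !(inj_eq (can_inj hK)) -(can2_eq hK gK).
Qed.

Lemma complete_multipartite2_cocktail_party (k : nat) :
  cocktail_party (complete_multipartite (fun _ : 'I_k => 2)).
Proof.
(* On ['I_2], [rev_ord] exchanges the two vertices of a partite set. *)
pose s (u : {i : 'I_k & 'I_2}) : {i : 'I_k & 'I_2} :=
  Tagged (fun _ => 'I_2) (i := tag u) (rev_ord (tagged u)).
exists s; split.
- by case=> i j; rewrite /s /= rev_ordK.
- by case=> i j; rewrite -tag_eqE /tag_eq /= eqxx /= tagged_asE; case: j => [[|[|]]].
- case=> i j [i' j']; rewrite /complete_multipartite -!tag_eqE /tag_eq /=.
  rewrite [i' == i]eq_sym; have [->|//] := eqVneq i i'.
  by rewrite !tagged_asE; move: j j' => [[|[|]] //= ?] [[|[|]] //= ?].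
Qed.

Lemma card_multipartite2 (k : nat) : #|{: {i : 'I_k & 'I_2}}| = k * 2.
Proof.
by rewrite card_tagged sumnE big_map big_enum /= sum_nat_const !card_ord.
Qed.

Lemma cocktail_party_K222 (V : finType) (e : rel V) :
  cocktail_party e -> is_K222 e.
Proof.
case=> s [ss sx es].
(* One vertex of each pair [{x, s x}], the one enumerated first. *)
pose R := [set x | enum_rank x < enum_rank (s x)].
have sR x : (s x \in R) = (x \notin R).
  by rewrite !inE ss -leqNgt ltn_neqAle (inj_eq (@ord_inj _)) (inj_eq enum_rank_inj) sx.
(* Parts are indexed by their representatives in [R]; the second coordinate chooses between
   representative and partner. *)
pose g (u : {i : 'I_#|R| & 'I_2}) : V :=
  if tagged u == ord0 then enum_val (tag u) else s (enum_val (tag u)).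
have g_surj x : exists u, g u == x.
  have [xR|xR] := boolP (x \in R).
    exists (Tagged (fun _ => 'I_2) (i := enum_rank_in xR x) ord0).
    by rewrite /g /= enum_rankK_in.
  rewrite -sR in xR; exists (Tagged (fun _ => 'I_2) (i := enum_rank_in xR (s x)) ord_max).
  by rewrite /g /= enum_rankK_in // ss.
have g_mem u : (g u \in R) = (tagged u == ord0).
  by rewrite /g; case: ifP => _; rewrite ?sR enum_valP.
have g_inj : injective g.
  case=> i j [i' j'] eqg.
  have jj : (j == ord0) = (j' == ord0).
    by rewrite -(g_mem (existT _ i j)) eqg g_mem.
  have ii : i = i'.
    move: eqg; rewrite /g /= jj; case: ifP => _; last move/(can_inj ss).
      exact: enum_val_inj.
    exact: enum_val_inj.
  rewrite ii; congr (Tagged _ _); apply: val_inj.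
  by move: j j' jj {eqg} => [[|[|]] //= ?] [[|[|]] //= ?].
pose h x := xchoose (g_surj x).
have hK : cancel h g by move=> x; apply/eqP; exact: xchooseP (g_surj x).
have gK : cancel g h by move=> u; apply: g_inj; rewrite hK.
exists #|R|; exists h; first by exists g.
move=> u v; rewrite -[u]hK -[v]hK !gK es.
case: (h u) (h v) => i j [i' j']; rewrite /complete_multipartite /=.
rewrite (inj_eq g_inj) /g /=.
have [<-|ii] := eqVneq i i'.
  apply/esym/negbTE; rewrite -tag_eqE /tag_eq /= eqxx tagged_asE.
  move: j j' => [[|[|]] //= ?] [[|[|]] //= ?]; rewrite -?val_eqE /= ?eqxx ?ss ?eqxx //.
apply/esym; rewrite -tag_eqE /tag_eq /= [i' == i]eq_sym (negbTE ii) /=.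
(* If [s] links the two images, membership in [R] excludes equal second coordinates, and different
   ones give [i = i']. *)
apply: contra ii => /eqP eqg.
have := g_mem (existT _ i' j'); rewrite /g /= eqg.
have vR (l : 'I_#|R|) : enum_val l \in R by exact: enum_valP.
move: eqg; case: ifP => _; case: ifP => _ eqg.
- by rewrite sR vR.
- by move: eqg; rewrite ss => /enum_val_inj ->.
- by move: eqg => /(can_inj ss)/enum_val_inj ->.
- by rewrite ss vR.
Qed.

(** * Even cliques with a perfect matching deleted *)

Lemma cocktail_party_card_even (V : finType) (e : rel V) :
  cocktail_party e -> ~~ odd #|V|.
Proof.
move=> /cocktail_party_K222[k [h bh _]].
by rewrite (bij_eq_card bh) card_multipartite2 muln2 odd_double.
Qed.

Lemma eq_set2_other (T : finType) (x y z : T) :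
  y != x -> [set x; y] = [set x; z] -> y = z.
Proof.
by move=> yx /setP/(_ y); rewrite !inE eqxx orbT (negbTE yx) => /esym/eqP.
Qed.

(** The deleted matching consists of the orbits of [s], transported to ordinals by [enum_rank]. *)
Lemma cocktail_party_clique_minus_matching (V : finType) (e : rel V) :
  cocktail_party e -> is_even_clique_minus_perfect_matching e.
Proof.
move=> cp; have oddV := cocktail_party_card_even cp; case: cp => s [ss sx es].
pose t (i : 'I_#|V|) := enum_rank (s (enum_val i)).
have tt : involutive t by move=> i; rewrite /t enum_rankK ss enum_valK.
have tx i : t i != i by rewrite (can2_eq (@enum_rankK V) (@enum_valK V)).
pose M := [set [set i; t i] | i : 'I_#|V|].
have MP i j : j != i -> ([set i; j] \in M) = (j == t i).
  move=> ji; apply/imsetP/eqP => [[l _ eqM]|->]; last by exists i.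
  have : i \in [set l; t l] by rewrite -eqM !inE eqxx.
  rewrite !inE => /orP[]/eqP il; rewrite -il in eqM.
    exact: eq_set2_other eqM.
  by rewrite il tt; apply: eq_set2_other ji _; rewrite eqM setUC.
exists #|V|, M; split=> //.
  split=> [A /imsetP[i _ ->]|i].
    by exists i, (t i); rewrite /clique eq_sym tx.
  exists [set i; t i]; split.
    by rewrite !inE eqxx; split=> //; apply/imsetP; exists i.
  move=> A [/imsetP[l _ ->]]; rewrite !inE => /orP[]/eqP -> //.
  by rewrite tt setUC.
exists enum_rank; first exact: enum_rank_bij.
move=> u v; rewrite /delete_edges /clique (inj_eq enum_rank_inj) es eq_sym.
have [//|vu] := eqVneq u v.
by rewrite MP /t ?enum_rankK (inj_eq enum_rank_inj) // eq_sym.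
Qed.

(** The involution sends each vertex to its partner in [M]; the unique matching edge at a vertex
    makes the partner unique. *)
Lemma clique_minus_matching_cocktail_party (m : nat) (M : {set {set 'I_m}}) :
  perfect_matching (@clique m) M -> cocktail_party (delete_edges (@clique m) M).
Proof.
case=> Medge Mcov.
have ex x : exists y, (y != x) && ([set x; y] \in M).
  have [A [[AM xA] _]] := Mcov x; have [u [v [uv eqA]]] := Medge A AM.
  move: xA AM; rewrite eqA !inE => /orP[]/eqP-> uvM.
    by exists v; rewrite uvM andbT eq_sym.
  by exists u; rewrite setUC uvM andbT.
have uni x y z : y != x -> [set x; y] \in M -> [set x; z] \in M -> y = z.
  move=> yx xyM xzM; apply: (eq_set2_other yx).
  have [A [_ Au]] := Mcov x.
  by rewrite -(Au [set x; y]) ?(Au [set x; z]) // !inE eqxx.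
pose s x := xchoose (ex x).
have sx x : s x != x by have /andP[] := xchooseP (ex x).
have sM x : [set x; s x] \in M by have /andP[] := xchooseP (ex x).
exists s; split=> // [x|u v].
  by apply: (uni (s x)) => //; rewrite setUC.
rewrite /delete_edges /clique eq_sym; have [//|vu] := eqVneq v u.
congr (~~ _); apply/idP/eqP => [uvM|->]; last exact: sM.
exact: uni vu uvM (sM u).
Qed.

Theorem theorem4p4 (n : nat) (V : finType) (e : rel V) :
  4 <= n -> simple_graph e -> connected_graph e -> #|V| = n ->
  ((vp_minus e = n - 2 /\ vp e = n - 2) <->
     is_even_clique_minus_perfect_matching e) /\
  ((vp_minus e = n - 2 /\ vp e = n - 2) <-> is_K222 e).
Proof.
move=> n4 [sym irr] con Vn; rewrite -Vn in n4 *.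
(* Both equivalences of the theorem pass through this one. *)
have vpE : (vp_minus e = #|V| - 2 /\ vp e = #|V| - 2) <-> cocktail_party e.
  rewrite position_number_const ?leq_subr ?(leq_trans _ n4) //; split.
    exact: position_number_cocktail_party.
  by move=> cp x; exact: cocktail_party_position_number.
split; rewrite vpE; split.
- exact: cocktail_party_clique_minus_matching.
- case=> m [M [_ pM iso]].
  exact: cocktail_party_iso iso (clique_minus_matching_cocktail_party pM).
- exact: cocktail_party_K222.
- case=> k iso.
  exact: cocktail_party_iso iso (complete_multipartite2_cocktail_party k).
Qed.
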